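(* Let $Y$ be a real vector space. Assume that $C\subset Y$ is a non-trivial algebraically closed convex cone and $k\in-\operatorname{core}C$. For the Minkowski functional $p_{C+k}$ of the set $C+k$ we have $$p_{C+k}(y)=\begin{cases}\varphi_{C,k}(y)&\text{if } y\in Y\setminus C,\\0&\text{if } y\in C,\end{cases}$$ i.e. $p_{C+k}(y)=\max\{\varphi_{C,k}(y),0\}$ for all $y\in Y$. The functional $p_{C+k}$ is finite-valued and sublinear.
   Context: For $A\subseteq Y$, the Minkowski functional is $p_A(y)=\inf\{\lambda>0\mid y\in\lambda A\}$. For nonempty $A\subseteq Y$ and $k\in Y\setminus\{0\}$, $\varphi_{A,k}(y):=\inf\{t\in\mathbb{R}\mid y\in A+tk\}$ for $y\in Y$, where $\inf\emptyset:=\nu$ with $\nu$ a symbol not in $\mathbb{R}\cup\{-\infty,+\infty\}$, and the infimum is $-\infty$ if the set is unbounded below. Finite-valued means real-valued on all of $Y$; sublinear means convex and positively homogeneous. A set $C\subseteq Y$ is a cone iff $\lambda c\in C$ for all $\lambda\in[0,\infty)$, $c\in C$; non-trivial iff $C\ne\emptyset$, $C\ne\{0\}$, $C\ne Y$; algebraically closed iff for all $c\in C$, $y\in Y$: if $c+\lambda(y-c)\in C$ for all $\lambda\in(0,1)$, then $y\in C$. $\operatorname{core}C$ is the algebraic interior: $c\in\operatorname{core}C$ iff $c\in C$ and for each $v\in Y$ there is $\varepsilon>0$ with $c+sv\in C$ for all $s\in[0,\varepsilon]$. *)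

(* Defs.v *)
(* MathComp / MathComp-Analysis. *)
From HB Require Import structures.
From mathcomp Require Import all_boot all_order all_algebra.
From mathcomp Require Import boolp classical_sets reals ereal convex.

Set Implicit Arguments.
Unset Strict Implicit.
Unset Printing Implicit Defensive.

Import Order.TTheory GRing.Theory Num.Theory.

Local Open Scope classical_set_scope.
Local Open Scope ring_scope.

(* [None] is the symbol nu, distinct from every real number and from both
   infinities; it is the infimum of the empty set. *)
Definition inf_nu (R : realType) (S : set R) : option (\bar R) :=
  if `[< S = set0 >] then None else Some (ereal_inf (EFin @` S)).

Section functionals.
Variables (R : realType) (Y : lmodType R).
Implicit Types (A C : set Y) (y k v : Y).

Definition scale_set (l : R) A : set Y := [set l *: a | a in A].

Definition translate A v : set Y := [set a + v | a in A].

Definition minkowski A y : option (\bar R) :=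
  inf_nu [set l : R | 0 < l /\ scale_set l A y].

(* Meant for nonempty [A] and nonzero [k]. *)
Definition phi A k y : option (\bar R) :=
  inf_nu [set t : R | translate A (t *: k) y].

(* The empty set is a cone in this sense. *)
Definition is_cone C := forall (l : R) c, 0 <= l -> C c -> C (l *: c).

Definition nontrivial_cone C := [/\ C <> set0, C <> [set 0] & C <> setT].

Definition algebraically_closed C := forall c y, C c ->
  (forall l : R, 0 < l -> l < 1 -> C (c + l *: (y - c))) -> C y.

Definition core C : set Y := [set c | C c /\
  forall v, exists2 e : R, 0 < e & forall s : R, 0 <= s <= e -> C (c + s *: v)].

(* [0 < l] and [0 <= l] are equivalent here, since [f 0 = 2 * f 0] gives
   [f 0 = 0]. *)
Definition positively_homogeneous (f : Y -> R) :=
  forall (l : R) y, 0 <= l -> f (l *: y) = l * f y.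

Definition sublinear (f : Y -> R) :=
  convex_function setT f /\ positively_homogeneous f.

End functionals.

(* Main.v *)
Require Import Defs.
From mathcomp Require Import all_boot all_order all_algebra.
From mathcomp Require Import boolp classical_sets reals ereal convex.
From mathcomp Require Import interval_inference lra.

Import Order.TTheory GRing.Theory Num.Theory.

Local Open Scope classical_set_scope.
Local Open Scope ring_scope.

(** Write [k = - c] with [c] in the core of [C].  Both functionals are then
governed by the lines [t |-> y + t *: c]: unfolding the definitions,
[y \in C + t *: k] means [y + t *: c \in C], while [y \in l *: (C + k)]
means, for [l > 0], that [y + l *: c \in C], because [C] is invariant under
positive scaling.  Hence [phi C k y] is the infimum of
[S_y = {t | y + t *: c \in C}] and the Minkowski functional is the infimum of
the positive elements of [S_y].

The point is that [S_y] is a closed ray [[g y, +oo[] (lemma [thresholdP]).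
It is upward closed since [C] is stable under addition; it is nonempty since
a core point of a cone absorbs every direction ([core_absorbing]); it is
bounded below since otherwise [- c] would belong to [C], which forces [C] to be
the whole space ([core_opp]); and it contains its infimum since [C] is
algebraically closed.  So [phi C k y = g y], the Minkowski functional is
[max (g y) 0], and [y \in C] holds exactly when [g y <= 0].

Sublinearity is read off the epigraph: [max (g y) 0 <= t] means that [0 <= t]
and [y + t *: c \in C], and these pairs [(y, t)] form a convex cone. *)

(** Membership of the endpoint [a] is left open so that one lemma computes both
    functionals: the ray [[g y, +oo[] contains its endpoint, whereas its trace
    on the positive reals does not when [g y <= 0]. *)
Lemma inf_nu_ray (R : realType) (S : set R) (a : R) :
  (forall t, S t -> a <= t) -> (forall t, a < t -> S t) ->
  inf_nu S = Some a%:E.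
Proof.
move=> lbS rayS.
have S0 : S !=set0 by exists (a + 1); apply: rayS; rewrite ltrDl.
have lb : has_lbound S by exists a => t /lbS.
rewrite /inf_nu asboolF; last by case: S0 => t St S0; rewrite S0 in St.
rewrite ereal_inf_EFin//; congr (Some _%:E).
apply/eqP; rewrite eq_le lb_le_inf// andbT.
by apply/ler_addgt0Pr => e e0; apply: ge_inf => //; apply: rayS; rewrite ltrDl.
Qed.

(** A subadditive, positively homogeneous function is convex, and for
    homogeneity one inequality is enough because scaling by [l] can be undone. *)
Lemma sublinear_subadditive (R : realType) (Y : lmodType R) (f : Y -> R) :
  f 0 = 0 -> (forall x y, f (x + y) <= f x + f y) ->
  (forall l y, 0 < l -> f (l *: y) <= l * f y) -> sublinear f.
Proof.
move=> f0 fD fZle.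
have fZ : positively_homogeneous f.
  move=> l y; rewrite le0r => /orP[/eqP->|l0].
    by rewrite scale0r mul0r.
  apply/eqP; rewrite eq_le fZle//=.
  (* The reverse inequality is the assumed one for [l^-1] at [l *: y]. *)
  have := fZle l^-1 (l *: y); rewrite invr_gt0 => /(_ l0).
  by rewrite scalerA mulVf ?gt_eqF// scale1r ler_pdivlMl.
split=> // t x y _ _; rewrite convRE -!fZ ?ge0 ?subr_ge0 ?le1//.
exact: fD.
Qed.

Section cone.
Context (R : realType) (Y : lmodType R) (C : set Y).
Hypotheses (C_cone : is_cone C) (C_convex : convex_set C).

Lemma convex_cone_add x y : C x -> C y -> C (x + y).
Proof.
move=> Cx Cy.
have half_ge0 : 0 <= 2^-1 :> R by lra.
have half_le1 : 2^-1 <= 1 :> R by lra.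
(* The sum is twice the midpoint. *)
have := C_convex x y (Itv01 half_ge0 half_le1) (mem_set Cx) (mem_set Cy).
rewrite inE => /(C_cone 2 _ (ler0n _ _)).
rewrite /conv/= scalerDr !scalerA mulfV ?pnatr_eq0// scale1r.
by rewrite (_ : 2 * (1 - 2^-1) = 1) ?scale1r//; lra.
Qed.

(** Rescale a point [c + e *: y] of [C] with [e > 0] by [e^-1]. *)
Lemma core_absorbing c : core C c -> forall y, exists t, C (y + t *: c).
Proof.
move=> [_ cc] y; have [e e0 /(_ e)] := cc y.
rewrite lexx ltW// => /(_ isT) /(C_cone e^-1 _); rewrite invr_ge0 ltW//.
move=> /(_ isT); rewrite scalerDr scalerA mulVf ?gt_eqF// scale1r addrC.
by exists e^-1.
Qed.

(** If [- c] is in [C], so is the whole line spanned by [c], and every [y] differs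
    from a point of [C] by an element of that line. *)
Lemma core_opp c : core C c -> C (- c) -> C = setT.
Proof.
move=> cc CNc; apply/seteqP; split=> // y _.
have [t Ct] := core_absorbing c cc y.
case: (lerP 0 t) => t0.
  have := convex_cone_add _ _ Ct (C_cone t _ t0 CNc).
  by rewrite scalerN addrK.
have := convex_cone_add _ _ Ct (C_cone `|t| _ (normr_ge0 t) cc.1).
by rewrite ltr0_norm// scaleNr addrK.
Qed.

Definition threshold (c y : Y) : R := inf [set t : R | C (y + t *: c)].

(** The ray is bounded below for the following reason: if [y + t *: c] and
    [- y + s *: c] are in [C], then so is their sum [(t + s) *: c], and
    [t + s < 0] would put [- c] in [C]. *)
Lemma thresholdP c : algebraically_closed C -> C <> setT -> core C c ->
  forall y t, C (y + t *: c) <-> threshold c y <= t.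
Proof.
move=> C_closed C_proper cc y.
pose S := [set t : R | C (y + t *: c)].
have S0 : S !=set0 by have [t] := core_absorbing c cc y; exists t.
have S_up t u : S t -> t <= u -> S u.
  move=> St tu; have := C_cone (u - t) c; rewrite subr_ge0.
  move=> /(_ tu cc.1) /(convex_cone_add _ _ St).
  by rewrite -addrA -scalerDl subrKC.
have Slb : has_lbound S.
  have [s Cs] := core_absorbing c cc (- y).
  exists (- s) => t St; rewrite leNgt; apply/negP => ts.
  apply: C_proper; apply: (core_opp c cc).
  have ts0 : 0 < - (t + s) by lra.
  have := convex_cone_add _ _ St Cs.
  rewrite addrACA subrr add0r -scalerDl => /(C_cone (- (t + s))^-1).
  rewrite invr_ge0 ltW// => /(_ isT).
  by rewrite scalerA invrN mulNr mulVf ?scaleN1r// -oppr_eq0 gt_eqF.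
have S_above t : inf S < t -> S t.
  by move=> /(inf_lt S0)[u Su /ltW]; exact: S_up.
move=> t; split=> [St|]; first exact: ge_inf.
apply: S_up; rewrite /S/=.
(* Algebraic closedness along the segment from [y + (inf S + 1) *: c] down to
   [y + inf S *: c]. *)
apply: (C_closed (y + (inf S + 1) *: c)).
  by apply: S_above; rewrite ltrDl.
move=> l l0 l1.
rewrite opprD addrACA subrr add0r -scalerBl scalerA -addrA -scalerDl.
by apply: S_above; lra.
Qed.

Lemma translate_oppE c t y : translate C (t *: - c) y <-> C (y + t *: c).
Proof.
split=> [[a Ca <-]|Cy]; first by rewrite scalerN subrK.
by exists (y + t *: c) => //; rewrite scalerN addrK.
Qed.

Lemma scale_translate_oppE c l y : 0 < l ->
  scale_set l (translate C (- c)) y <-> C (y + l *: c).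
Proof.
move=> l0; split=> [[_ [a Ca <-] <-]|Cy].
  by rewrite scalerBr subrK; apply: C_cone => //; exact: ltW.
exists (l^-1 *: y); last by rewrite scalerA mulfV ?gt_eqF// scale1r.
exists (l^-1 *: (y + l *: c)); first by apply: C_cone; rewrite // invr_ge0 ltW.
by rewrite scalerDr scalerA mulVf ?gt_eqF// scale1r addrK.
Qed.

End cone.

Theorem proposition10 (R : realType) (Y : lmodType R) (C : set Y) (k : Y)
    (C_cone : is_cone C) (C_nontrivial : nontrivial_cone C)
    (C_closed : algebraically_closed C) (C_convex : convex_set C)
    (k_core : [set - c | c in core C] k) :
  [/\ forall y : Y, ~ C y -> minkowski (translate C k) y = phi C k y,
      forall y : Y, C y -> minkowski (translate C k) y = Some 0%E,
      forall y : Y, minkowski (translate C k) y =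
        omap (fun a : \bar R => Order.max a 0%E) (phi C k y) &
      exists f : Y -> R,
        (forall y : Y, minkowski (translate C k) y = Some (f y)%:E) /\
        sublinear f].
Proof.
case: C_nontrivial => _ _ C_proper; case: k_core => c cc <-{k}.
have gP := thresholdP _ _ _ C_cone C_convex c C_closed C_proper cc.
set g := threshold _ _ C c in gP.
have phiE y : phi C (- c) y = Some (g y)%:E.
  apply: inf_nu_ray => t; first by move/translate_oppE/gP.
  by move/ltW/gP/translate_oppE.
pose f y := Num.max (g y) 0.
have minkowskiE y : minkowski (translate C (- c)) y = Some (f y)%:E.
  apply: inf_nu_ray => t; rewrite /f ?ge_max ?gt_max.
    by move=> [t0 /(scale_translate_oppE _ _ _ C_cone c _ y t0)/gP ->]; rewrite ltW.
  move=> /andP[/ltW/gP Cyt t0]; split=> //.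
  exact/scale_translate_oppE.
have gle0 y : C y <-> g y <= 0 by rewrite -gP scale0r addr0.
have fP y t : f y <= t <-> 0 <= t /\ C (y + t *: c).
  by rewrite /f ge_max gP; split=> [/andP[]|[-> ->]].
split=> [y|y|y|].
- move=> /gle0/negP; rewrite -ltNge => /ltW g0.
  by rewrite minkowskiE phiE /f max_l.
- by move=> /gle0 g0; rewrite minkowskiE /f max_r.
- by rewrite minkowskiE phiE /= EFin_max.
- exists f; split=> //; have f_ge0 y : 0 <= f y by rewrite le_max lexx orbT.
  have Cf y : C (y + f y *: c) by have /fP[] := lexx (f y).
  apply: sublinear_subadditive => [|x y|l y l0].
  + apply/eqP; rewrite eq_le f_ge0 andbT; apply/fP; split=> //.
    by rewrite scale0r addr0 -(scale0r c); apply: C_cone => //; exact: cc.1.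
  + apply/fP; split; first exact: addr_ge0.
    by rewrite scalerDl addrACA; exact: convex_cone_add.
  + apply/fP; split; first by rewrite mulr_ge0// ltW.
    by rewrite -scalerA -scalerDr; apply: C_cone => //; exact: ltW.
Qed.
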